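(* Let $X$ be a measurable space, let $\mathcal{H}$ be a complex separable Hilbert space, and let $\mu$ be a $C^*$-extreme point in $\mathcal{P}_{\mathcal{H}}(X)$. If $E\in\mathcal{O}(X)$ is such that $\mu(A)\mu(E)=\mu(E)\mu(A)$ for all $A\subseteq E$ with $A\in\mathcal{O}(X)$, then $\mu(E)$ is a projection. In particular, if $\mu(E)$ commutes with $\mu(B)$ for all $B\in\mathcal{O}(X)$, then $\mu(E)$ is a projection.
   Context: A measurable space is a nonempty set $X$ with a $\sigma$-algebra $\mathcal{O}(X)$ of subsets; all singletons are assumed measurable. $\mathcal{B}(\mathcal{H})$ denotes the bounded operators on $\mathcal{H}$; the inner product is linear in the second variable; a projection is a self-adjoint idempotent. A positive operator valued measure (POVM) on $X$ with values in $\mathcal{B}(\mathcal{H})$ is a map $\mu:\mathcal{O}(X)\to\mathcal{B}(\mathcal{H})$ with $\mu(A)\ge 0$ for all $A$ and such that for all $h,k\in\mathcal{H}$ the map $A\mapsto\langle h,\mu(A)k\rangle$ is a complex measure. It is normalized if $\mu(X)=I_{\mathcal{H}}$. $\mathcal{P}_{\mathcal{H}}(X)$ is the set of all normalized POVMs on $X$ with values in $\mathcal{B}(\mathcal{H})$. A normalized POVM $\mu$ is a $C^*$-extreme point in $\mathcal{P}_{\mathcal{H}}(X)$ if, whenever $\mu(\cdot)=\sum_{i=1}^n T_i^*\mu_i(\cdot)T_i$ with $\mu_i\in\mathcal{P}_{\mathcal{H}}(X)$ and invertible $T_i\in\mathcal{B}(\mathcal{H})$ satisfying $\sum_{i=1}^n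 T_i^*T_i=I_{\mathcal{H}}$, there are unitaries $U_i\in\mathcal{B}(\mathcal{H})$ such that $\mu_i(\cdot)=U_i^*\mu(\cdot)U_i$ for $1\le i\le n$. *)

(* Defs.v *)
From HB Require Import structures.
From mathcomp Require Import all_boot all_order all_algebra.
From mathcomp Require Import complex.
From mathcomp Require Import all_classical all_reals all_analysis.

Set Implicit Arguments.
Unset Strict Implicit.
Unset Printing Implicit Defensive.

Import Order.TTheory GRing.Theory Num.Theory.
Import numFieldNormedType.Exports.

Local Open Scope classical_set_scope.
Local Open Scope complex_scope.
Local Open Scope ring_scope.

HB.mixin Record CompleteNormedModule_isHilbert (R : realType) H
    & CompleteNormedModule R[i] H := {
  hdot : {dot H for (@Num.conj R[i])} ;
  hdotE : forall x : H, hdot x x = `|x| ^+ 2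
}.

#[short(type="hilbertType")]
HB.structure Definition Hilbert (R : realType) :=
  {H of CompleteNormedModule R[i] H & CompleteNormedModule_isHilbert R H}.

(* The forms {dot _ for _} are linear in their first argument; the inner
   product used here is linear in the second one. *)
Definition inner (R : realType) (H : hilbertType R) (h k : H) : R[i] :=
  hdot k h.

Section InnerTheory.
Context {R : realType} {H : hilbertType R}.
Implicit Types (h k l : H) (a : R[i]).

Lemma innerC h k : inner h k = Num.conj (inner k h).
Proof. by rewrite /inner hermC expr0 mul1r. Qed.
Lemma innerDr h k l : inner h (k + l) = inner h k + inner h l.
Proof. by rewrite /inner linearDl. Qed.
Lemma innerZr a h k : inner h (a *: k) = a * inner h k.
Proof. by rewrite /inner linearZl_LR. Qed.
Lemma innerxx h : inner h h = `|h| ^+ 2.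
Proof. exact: hdotE. Qed.

End InnerTheory.

Definition separable_space (T : topologicalType) :=
  exists2 S : set T, countable S & dense S.

Section BoundedOperators.
Context {R : realType} {H : hilbertType R}.

Definition bounded_linear (f : H -> H) :=
  linear f /\ exists M : R[i], forall x, `|f x| <= M * `|x|.

Definition bounded_linear_pred : {pred H -> H} :=
  fun f => `[< bounded_linear f >].

Lemma bounded_linearP f : reflect (bounded_linear f) (f \in bounded_linear_pred).
Proof. exact: asboolP. Qed.

Lemma bounded_linear_submod_closed : submod_closed bounded_linear_pred.
Proof.
split.
  apply/bounded_linearP; split=> [a x y|].
    by rewrite /GRing.zero /= scaler0 addr0.
  by exists 0 => x; rewrite /GRing.zero /= normr0 mul0r.
move=> a f g /bounded_linearP[fl [Mf fM]] /bounded_linearP[gl [Mg gM]].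
apply/bounded_linearP; split=> [b x y|].
  rewrite !fctE fl gl !scalerDr !scalerA (mulrC a b) -!addrA; congr (_ + _).
  by rewrite addrCA.
exists (`|a| * Mf + Mg) => x; rewrite !fctE mulrDl.
apply: (le_trans (ler_normD _ _)).
by rewrite lerD// normrZ -mulrA ler_wpM2l.
Qed.

HB.instance Definition _ :=
  GRing.isSubmodClosed.Build R[i] (H -> H) bounded_linear_pred
    bounded_linear_submod_closed.

End BoundedOperators.

Record bop (R : realType) (H : hilbertType R) := Bop {
  bop_fun :> H -> H ;
  _ : bop_fun \in bounded_linear_pred
}.

HB.instance Definition _ (R : realType) (H : hilbertType R) :=
  [isSub of bop H for @bop_fun R H].
HB.instance Definition _ (R : realType) (H : hilbertType R) :=
  [Choice of bop H by <:].
HB.instance Definition _ (R : realType) (H : hilbertType R) :=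
  [SubChoice_isSubLmodule of bop H by <:].

Section BopRing.
Context {R : realType} {H : hilbertType R}.
Implicit Types S T U : bop H.

Lemma bopP S T : S =1 T <-> S = T.
Proof. by split=> [/funext ST|->//]; apply: val_inj. Qed.

Lemma bop_linear T : linear T.
Proof. by case: T => f /= /bounded_linearP[]. Qed.

HB.instance Definition _ T :=
  GRing.isLinear.Build R[i] H H *:%R T (bop_linear T).

Lemma bop_bounded T : exists M : R[i], forall x, `|T x| <= M * `|x|.
Proof. by case: T => f /= /bounded_linearP[]. Qed.

Lemma bop_one_subproof : idfun \in @bounded_linear_pred R H.
Proof.
apply/bounded_linearP; split=> // .
by exists 1 => x; rewrite mul1r.
Qed.

Lemma bop_mul_subproof S T : S \o T \in @bounded_linear_pred R H.
Proof.
apply/bounded_linearP; split=> [a x y|]; first by rewrite /= !linearP.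
have [MS SM] := bop_bounded S; have [MT TM] := bop_bounded T.
have le_normM x y (M : R[i]) : `|x : H| <= M * `|y : H| ->
    `|x| <= `|M| * `|y|.
  move=> h; have := le_trans (normr_ge0 x) h => /ger0_norm.
  by rewrite normrM normr_id => ->.
exists (`|MS| * `|MT|) => x /=; rewrite -mulrA.
apply: le_trans (le_normM _ _ _ (SM _)) _.
by rewrite ler_wpM2l// le_normM.
Qed.

Definition bop_one : bop H := Bop bop_one_subproof.
Definition bop_mul S T : bop H := Bop (bop_mul_subproof S T).

Lemma bop_mulA : associative bop_mul.
Proof. by move=> S T U; apply/bopP. Qed.
Lemma bop_mul1 : left_id bop_one bop_mul.
Proof. by move=> S; apply/bopP. Qed.
Lemma bop_mulr1 : right_id bop_one bop_mul.
Proof. by move=> S; apply/bopP. Qed.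
Lemma bop_mulDl : left_distributive bop_mul +%R.
Proof. by move=> S T U; apply/bopP. Qed.
Lemma bop_mulDr : right_distributive bop_mul +%R.
Proof. by move=> S T U; apply/bopP=> x /=; rewrite [LHS]linearD. Qed.

(* The zero space is allowed, so that 1 = 0 may hold in bop H: it is only
   a pzRing. *)
HB.instance Definition _ := GRing.Zmodule_isPzRing.Build (bop H)
  bop_mulA bop_mul1 bop_mulr1 bop_mulDl bop_mulDr.

Lemma bopDE S T x : (S + T) x = S x + T x. Proof. by []. Qed.
Lemma bopNE T x : (- T) x = - T x. Proof. by []. Qed.
Lemma bopZE a T x : (a *: T) x = a *: T x. Proof. by []. Qed.
Lemma bopME S T x : (S * T) x = S (T x). Proof. by []. Qed.
Lemma bop0E x : (0 : bop H) x = 0. Proof. by []. Qed.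
Lemma bop1E x : (1 : bop H) x = x. Proof. by []. Qed.

Lemma bop_scalerAl (a : R[i]) S T : a *: (S * T) = (a *: S) * T.
Proof. by apply/bopP. Qed.

Lemma bop_scalerAr (a : R[i]) S T : a *: (S * T) = S * (a *: T).
Proof. by apply/bopP=> x; rewrite bopME bopZE linearZ. Qed.

End BopRing.

Section OperatorClasses.
Context {R : realType} {H : hilbertType R}.
Implicit Types S T : bop H.

(* By the Riesz representation theorem this set is a singleton, so that the
   default value 0 is never used. *)
Definition adj T : bop H :=
  xget 0 [set S : bop H | forall h k, inner (S h) k = inner h (T k)].

(* [0 <= z] in R[i] says that z is real and nonnegative. *)
Definition positive_op T := forall h : H, 0 <= inner h (T h).

Definition projection T := adj T = T /\ T * T = T.

Definition unitary T := adj T * T = 1 /\ T * adj T = 1.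

Definition invertible T := exists S, S * T = 1 /\ T * S = 1.

End OperatorClasses.

Section POVM.
Context {d : measure_display} {X : measurableType d}.
Context {R : realType} {H : hilbertType R}.

Definition complex_measure (m : set X -> R[i]) :=
  forall A : (set X)^nat, (forall n, measurable (A n)) -> trivIset setT A ->
    (fun n => \sum_(0 <= j < n) m (A j) : R[i]^o) @ \oo -->
      (m (\bigcup_n A n) : R[i]^o).

(* An operator-valued set function is a total function on sets; only its values
   on measurable sets are ever constrained or compared. *)
Definition povm (mu : set X -> bop H) :=
  (forall A, measurable A -> positive_op (mu A)) /\
  (forall h k : H, complex_measure (fun A => inner h (mu A k))).

Definition normalized_povm (mu : set X -> bop H) :=
  povm mu /\ mu setT = 1.

Definition cstar_extreme (mu : set X -> bop H) :=
  normalized_povm mu /\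
  forall (n : nat) (nu : 'I_n -> set X -> bop H) (T : 'I_n -> bop H),
    (forall i, normalized_povm (nu i)) ->
    (forall i, invertible (T i)) ->
    \sum_(i < n) adj (T i) * T i = 1 ->
    (forall A, measurable A ->
       mu A = \sum_(i < n) adj (T i) * nu i A * T i) ->
    exists U : 'I_n -> bop H,
      (forall i, unitary (U i)) /\
      (forall i A, measurable A -> nu i A = adj (U i) * mu A * U i).

End POVM.

(* Main.v *)
Require Import Defs.
From HB Require Import structures.
From mathcomp Require Import all_boot all_order all_algebra.
From mathcomp Require Import complex ring lra.
From mathcomp Require Import all_classical all_reals all_analysis.
Import Order.TTheory GRing.Theory Num.Theory.
Import numFieldNormedType.Exports.
Local Open Scope classical_set_scope.
Local Open Scope ring_scope.

(** Why it is true.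

    Write a for mu E and let 0 < s < 1.  Suppose first that some projection P
    that commutes with a and with all mu A, A inside E, cuts the spectrum of a
    at s: a >= s on the range of P and a <= s on its orthogonal complement.
    Then a has an inverse on the range of P, i.e. there is C = P C >= 0 with
    a C = P, and C <= P / s.  For 0 <= l with l (1 - s) <= 1 the operators

      K = (1 - P) + l P + (1 - l) C   and   M = (1 - P) + sqrt l P

    satisfy K >= 0 and K a + M (1 - a) M = 1, so that

      nu A = K mu(A & E) + M mu(A & ~E) M

    is again a normalized POVM; positivity of K mu(A & E) is where the
    commutation hypothesis enters.  If T = p (1 - P) + q P with l = p^2 / q^2,
    then T nu A T = p^2 mu A + (q^2 - p^2) C mu(A & E).  Two pairs (p, q) and
    (p', q') with p^2 + p'^2 = q^2 + q'^2 = 1 therefore write mu as a C*-convex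
    combination of two such tilted POVMs, and the coefficients T are invertible
    as soon as p, q, p' and q' are nonzero.

    With p^2 = s^2 / 2 and q^2 = s / 2 both pairs satisfy l (1 - s) <= 1, and
    the first one has l = s.  For it g = nu E = (1 - P) a + (1 - s (1 - a)) P is
    at most s off the range of P and at least 1 - s on it, so g - g^2 <= s.  By C*-extremality g is unitarily
    equivalent to a, so a - a^2 <= s; as s is arbitrary, a = a^2.

    The projection P comes from an operator sign.  Let b = a - s, a self-adjoint
    contraction.  The iteration x |-> x (3 - x^2) / 2 started at b converges
    strongly, because the iterates commute, keep the sign of the first one and
    have increasing squares, whence (x_n - x_m)^2 <= x_n^2 - x_m^2 for m <= n.
    The limit x satisfies x^3 = x and b x >= b^2, and P = (x^2 + x) / 2.
    The partial inverse C is a Neumann series, whose partial sums converge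
    strongly by a similar monotonicity argument.

    Both constructions only involve self-adjoint operators in the bicommutant
    of a.  These form a commutative ring, in which all operator identities can
    be checked by polynomial arithmetic, and positivity is multiplicative
    there because the product of two commuting positive operators is
    positive. *)

Set Implicit Arguments.
Unset Strict Implicit.
Unset Printing Implicit Defensive.

(** * The real inner product, self-adjoint and positive operators *)

Section RealInnerProduct.
Context {R : realType} {H : hilbertType R}.
Implicit Types (h k l : H) (c : R) (S T : bop H).

(** Order arguments take place in R; the real part of the inner product makes
    H a real Hilbert space with the same norm. *)
Definition rip h k : R := complex.Re (inner h k).

Lemma ripC h k : rip h k = rip k h.
Proof. by rewrite /rip innerC; case: (inner k h) => x y. Qed.

Lemma ripDr h k l : rip h (k + l) = rip h k + rip h l.
Proof. by rewrite /rip innerDr raddfD. Qed.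

Lemma ripZr c h k : rip h (c%:C%C *: k) = c * rip h k.
Proof. by rewrite /rip innerZr; case: (inner h k) => x y /=; rewrite mul0r subr0. Qed.

Lemma ripNr h k : rip h (- k) = - rip h k.
Proof. by rewrite -[RHS]mulN1r -ripZr rmorphN1 scaleN1r. Qed.

Lemma ripBr h k l : rip h (k - l) = rip h k - rip h l.
Proof. by rewrite ripDr ripNr. Qed.

Lemma ripr0 h : rip h 0 = 0.
Proof. by rewrite -(subrr h) ripBr subrr. Qed.

Lemma ripDl h k l : rip (h + k) l = rip h l + rip k l.
Proof. by rewrite !(ripC _ l) ripDr. Qed.

Lemma ripBl h k l : rip (h - k) l = rip h l - rip k l.
Proof. by rewrite !(ripC _ l) ripBr. Qed.

Lemma ripZl c h k : rip (c%:C%C *: h) k = c * rip h k.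
Proof. by rewrite !(ripC _ k) ripZr. Qed.

Lemma ripNl h k : rip (- h) k = - rip h k.
Proof. by rewrite !(ripC _ k) ripNr. Qed.

Definition ripE := (ripDl, ripDr, ripNl, ripNr, ripZl, ripZr).

Lemma normr_sqr h : `|h| ^+ 2 = (rip h h)%:C%C.
Proof.
by rewrite -innerxx /rip innerxx RRe_real.
Qed.

Lemma rip_ge0 h : 0 <= rip h h.
Proof. by rewrite -lecR -normr_sqr exprn_ge0. Qed.

Lemma rip_eq0 h : (rip h h == 0) = (h == 0).
Proof. by rewrite -(inj_eq (@complexI R)) -normr_sqr sqrf_eq0 normr_eq0. Qed.

Lemma rip_inj h k : (forall l, rip l h = rip l k) -> h = k.
Proof.
move=> hk; apply/eqP; rewrite -subr_eq0 -rip_eq0; apply/eqP.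
by rewrite ripBr hk subrr.
Qed.

(** The imaginary part is recovered from [rip], which makes it enough to check
    self-adjointness for [rip]. *)
Lemma Im_inner h k : complex.Im (inner h k) = - rip h ('i%C *: k).
Proof.
rewrite /rip innerZr; case: (inner h k) => x y /=.
by rewrite mul0r mul1r sub0r opprK.
Qed.

Lemma rip_CS h k : rip h k ^+ 2 <= rip h h * rip k k.
Proof.
have [->|k0] := eqVneq k 0.
  by rewrite ripr0 expr0n mulr_ge0 ?rip_ge0.
have kk : 0 < rip k k by rewrite lt_def rip_eq0 k0 rip_ge0.
have := rip_ge0 ((rip k k)%:C%C *: h - (rip h k)%:C%C *: k).
rewrite !ripE (ripC k h) => t.
rewrite -subr_ge0 -(pmulr_rge0 _ kk); apply: le_trans t _.
by rewrite le_eqVlt; apply/orP; left; apply/eqP; ring.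
Qed.

Definition selfadj T := forall h k, inner (T h) k = inner h (T k).

Lemma rip_selfadjP T : (forall h k, rip (T h) k = rip h (T k)) -> selfadj T.
Proof.
move=> sT h k; apply/eqP; rewrite eq_complex; apply/andP; split; apply/eqP.
  exact: sT.
by rewrite !Im_inner sT linearZ.
Qed.

Lemma selfadj_rip T h k : selfadj T -> rip (T h) k = rip h (T k).
Proof. by move=> sT; rewrite /rip sT. Qed.

(** The adjoint is unique when it exists, by nondegeneracy. *)
Lemma adjP S T : (forall h k, inner (S h) k = inner h (T k)) -> adj T = S.
Proof.
move=> ST; rewrite /adj; case: xgetP => [U _ /= UT|/(_ S) /=]; last by case.
apply/bopP => h; apply: rip_inj => l.
by rewrite ripC (ripC l) /rip UT ST.
Qed.

Lemma selfadj_adj T : selfadj T -> adj T = T.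
Proof. exact: adjP. Qed.

(** Polarization: the form of T is real at h, k and h + k, so that
    h, k |-> rip h (i T k) is antisymmetric; replacing h by i h gives the
    symmetry of rip h (T k). *)
Lemma positive_selfadj T : positive_op T -> selfadj T.
Proof.
move=> T0.
have im0 h : rip h ('i%C *: T h) = 0.
  by apply/eqP; rewrite -oppr_eq0 -Im_inner ger0_Im.
have anti h k : rip h ('i%C *: T k) = - rip k ('i%C *: T h).
  apply/eqP; rewrite -addr_eq0; apply/eqP.
  by have := im0 (h + k); rewrite linearD scalerDr !ripE !im0 add0r addr0.
have mulI l : 'i%C *: ('i%C *: l) = - l :> H.
  by rewrite scalerA -expr2 sqr_i scaleN1r.
have ripI h k : rip ('i%C *: h) ('i%C *: k) = rip h k.
  rewrite /rip innerZr (innerC _ k) innerZr (innerC h k).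
  case: (inner k h) => x y /=; ring.
apply: rip_selfadjP => h k.
have := anti ('i%C *: h) k; rewrite ripI linearZ mulI ripNr opprK.
by rewrite (ripC _ k) => ->.
Qed.

Lemma positive_opP T :
  positive_op T <-> selfadj T /\ forall h, 0 <= rip h (T h).
Proof.
split=> [T0|[sT T0] h].
  split; first exact: positive_selfadj.
  by move=> h; have := T0 h; rewrite lecE => /andP[].
rewrite lecE /=; apply/andP; split; last exact: T0.
apply/eqP; have := sT h h; rewrite innerC.
case: (inner h (T h)) => x y /= [/eqP].
by rewrite eq_sym -addr_eq0 -mulr2n mulrn_eq0 /= => /eqP.
Qed.

End RealInnerProduct.

(** * Products of commuting positive operators *)

Section PositiveProduct.
Context {R : realType} {H : hilbertType R}.
Implicit Types (h k : H) (A B T : bop H).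

Lemma ge0_ReK (z : R[i]) : 0 <= z -> (complex.Re z)%:C%C = z.
Proof. by move=> z0; rewrite RRe_real // ger0_real. Qed.

Lemma normrE h : `|h| = (Num.sqrt (rip h h))%:C%C.
Proof.
apply/eqP; rewrite -(eqrXn2 (ltn0Sn 1)) ?normr_ge0 ?ler0c ?sqrtr_ge0 //.
by rewrite normr_sqr -rmorphXn sqr_sqrtr ?rip_ge0.
Qed.

Lemma bop_rip_bounded T : exists2 M : R, 0 < M & forall h, rip (T h) (T h) <= M * rip h h.
Proof.
have [M TM] := bop_bounded T.
have [N N0 MN] : exists2 N : R, 0 <= N & `|M| ^+ 2 = N%:C%C.
  have M2 : 0 <= `|M| ^+ 2 by rewrite exprn_ge0.
  by exists (complex.Re (`|M| ^+ 2)); rewrite -?ler0c ge0_ReK.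
exists (N + 1); first by rewrite ltr_wpDl.
move=> h; apply: (@le_trans _ _ (N * rip h h)); last first.
  by rewrite ler_wpM2r ?rip_ge0 // lerDl.
have rcM (x y : R) : (x * y)%:C%C = x%:C%C * y%:C%C by rewrite rmorphM.
rewrite -lecR rcM -MN -!normr_sqr -exprMn lerXn2r ?nnegrE ?mulr_ge0 //.
have := le_trans (normr_ge0 _) (TM h) => /ger0_norm.
by rewrite normrM normr_id => ->.
Qed.

Lemma selfadjZ (c : R) T : selfadj T -> selfadj (c%:C%C *: T).
Proof.
move=> sT; apply: rip_selfadjP => h k.
by rewrite !bopZE !ripE selfadj_rip.
Qed.

Lemma selfadjB A B : selfadj A -> selfadj B -> selfadj (A - B).
Proof.
move=> sA sB; apply: rip_selfadjP => h k.
by rewrite !bopDE !bopNE !ripE !selfadj_rip.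
Qed.

Lemma selfadjM A B : A * B = B * A -> selfadj A -> selfadj B -> selfadj (A * B).
Proof.
move=> AB sA sB; apply: rip_selfadjP => h k.
by rewrite bopME !selfadj_rip // -bopME AB.
Qed.

Lemma positive_bounded A : exists2 M : R, 0 < M & forall h, rip h (A h) <= M * rip h h.
Proof.
have [M M0 AM] := bop_rip_bounded A; exists (M + 1); first by rewrite addr_gt0.
move=> h.
have := rip_ge0 (h - A h); rewrite !ripE (ripC (A h)) => t.
have := AM h; have := rip_ge0 h; have := rip_ge0 (A h).
have : 0 <= M * rip h h by rewrite mulr_ge0 ?rip_ge0 // ltW.
by lra.
Qed.

(** T - T^2 = T (1 - T) T + (1 - T) T (1 - T), evaluated at h. *)
Lemma rip_sqr_le_of_contraction T : selfadj T ->
  (forall h, 0 <= rip h (T h) <= rip h h) ->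
  forall h, rip (T h) (T h) <= rip h (T h).
Proof.
move=> sT T01 h.
have /andP[_ t1] := T01 (T h).
have /andP[t2 _] := T01 (h - T h).
move: t1 t2; rewrite linearB !ripE -!selfadj_rip //.
by rewrite (ripC (T h) h); lra.
Qed.

(** A = sum_(k < n) A_k^2 + A_n: a positive contraction is a sum of squares up
    to a remainder that is small, at any given vector, for suitable n. *)
Fixpoint riesz_seq A n :=
  if n is n'.+1 then riesz_seq A n' - riesz_seq A n' * riesz_seq A n' else A.

Lemma riesz_seqS A n h :
  riesz_seq A n.+1 h = riesz_seq A n h - riesz_seq A n (riesz_seq A n h).
Proof. by []. Qed.

Lemma riesz_seqP A n : selfadj A -> (forall h, 0 <= rip h (A h) <= rip h h) ->
  selfadj (riesz_seq A n) /\
  forall h, 0 <= rip h (riesz_seq A n h) <= rip h h.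
Proof.
move=> sA A01; elim: n => [//|n [sn n01]]; split=> [|h].
  by apply: selfadjB => //; apply: selfadjM.
rewrite riesz_seqS ripBr -selfadj_rip // subr_ge0 /=.
  apply/andP; split; first by rewrite -(selfadj_rip h _ sn) (ripC _ h) rip_sqr_le_of_contraction.
have /andP[_ t] := n01 h; rewrite (ripC _ h) -(selfadj_rip h _ sn).
by apply: le_trans t; rewrite (ripC _ h) gerBl -(selfadj_rip h (riesz_seq A n h) sn) rip_ge0.
Qed.

Lemma riesz_seq_comm A B n : A * B = B * A -> riesz_seq A n * B = B * riesz_seq A n.
Proof.
move=> AB; elim: n => [//|n IHn] /=.
by rewrite mulrBl mulrBr -mulrA IHn !mulrA IHn.
Qed.

(** <h, A B h> = sum_(k < n) <A_k h, B A_k h> + <A_n h, B h>.  If the left-hand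
    side were some r < 0, then <A_n h, B h> <= r for all n, so |A_n h|^2 would be
    bounded below, whereas the sum of the |A_k h|^2 is at most <h, A h>. *)
Lemma rip_mul_ge0_of_contraction A B : selfadj A -> (forall h, 0 <= rip h (A h) <= rip h h) ->
   (forall h, 0 <= rip h (B h)) -> A * B = B * A ->
   forall h, 0 <= rip h ((A * B) h).
Proof.
move=> sA A01 B0 AB h; rewrite leNgt; apply/negP => neg.
set r := rip h _ in neg.
pose An n := riesz_seq A n h.
have step n : rip (An n.+1) (B h) <= rip (An n) (B h).
  rewrite /An riesz_seqS ripBl gerBl.
  have [sn _] := riesz_seqP n sA A01.
  by rewrite selfadj_rip // -bopME riesz_seq_comm // bopME.
have le_r n : rip (An n) (B h) <= r.
  elim: n => [|n]; first by rewrite /An /= selfadj_rip.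
  exact/le_trans.
have sums n : n%:R * r ^+ 2 <= (rip h (A h) - rip h (An n)) * rip (B h) (B h).
  elim: n => [|n IHn]; first by rewrite mul0r subrr mul0r.
  have [sn _] := riesz_seqP n sA A01.
  have -> : rip h (A h) - rip h (An n.+1) = rip h (A h) - rip h (An n) + rip (An n) (An n).
    by rewrite /An riesz_seqS ripBr -(selfadj_rip h (riesz_seq A n h) sn) opprB addrA addrAC.
  rewrite -natr1 mulrDl mul1r [leRHS]mulrDl lerD //.
  apply: le_trans (rip_CS _ _).
  rewrite -sqrrN -[leRHS]sqrrN lerXn2r ?nnegrE ?lerN2 //.
    by rewrite oppr_ge0 ltW.
  by rewrite oppr_ge0 (le_trans (le_r n)) // ltW.
pose c := rip h (A h) * rip (B h) (B h) / r ^+ 2.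
have r2 : 0 < r ^+ 2 by rewrite exprn_even_gt0 //= lt_eqF.
have [n] : exists n, c < n%:R.
  exists (Num.bound `|c|).
  exact: le_lt_trans (ler_norm c) (archi_boundP (normr_ge0 c)).
rewrite /c ltr_pdivrMr // ltNge => /negP; apply.
apply: le_trans (sums n) _; rewrite ler_wpM2r ?rip_ge0 // gerBl.
by have [_ /(_ h)/andP[]] := riesz_seqP n sA A01.
Qed.

Lemma rip_mul_ge0 A B : selfadj A -> (forall h, 0 <= rip h (A h)) ->
   (forall h, 0 <= rip h (B h)) -> A * B = B * A ->
   forall h, 0 <= rip h ((A * B) h).
Proof.
move=> sA A0 B0 AB h.
have [M M0 AM] := positive_bounded A.
rewrite -(pmulr_rge0 _ (_ : 0 < M^-1)) ?invr_gt0 // -ripZr -bopZE bop_scalerAl.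
apply: rip_mul_ge0_of_contraction => //; first exact: selfadjZ.
  move=> k; rewrite bopZE ripZr mulr_ge0 ?invr_ge0 ?(ltW M0) //=.
  by rewrite ler_pdivrMl.
by rewrite -bop_scalerAl AB bop_scalerAr.
Qed.

End PositiveProduct.

(** * Strong limits of operators *)

Section StrongLimits.
Context {R : realType} {H : hilbertType R}.
Implicit Types (h k l : H) (A B T : bop H) (v : H ^nat).

Lemma gt0_complexP (e : R[i]) : 0 < e -> exists2 r : R, 0 < r & e = r%:C%C.
Proof.
move=> e0; exists (complex.Re e); last by rewrite ge0_ReK // ltW.
by rewrite -ltcR ge0_ReK // ltW.
Qed.

Lemma cvg_ripP v l : (v n @[n --> \oo] --> l) <->
  (rip (v n - l) (v n - l) @[n --> \oo] --> 0).
Proof.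
split=> [/cvgrPdist_lt vl|/cvgrPdist_lt vl]; apply/cvgrPdist_lt => e e0.
  have s0 : 0 < (Num.sqrt e)%:C%C :> R[i] by rewrite ltcR sqrtr_gt0.
  move: (vl _ s0); apply: filterS => n.
  rewrite distrC normrE ltcR sub0r normrN ger0_norm ?rip_ge0 //.
  by rewrite ltr_sqrt.
have [r r0 ->] := gt0_complexP e0.
move: (vl _ (exprn_gt0 2 r0)); apply: filterS => n.
rewrite sub0r normrN ger0_norm ?rip_ge0 // => t; rewrite distrC normrE ltcR.
rewrite -(@ltr_pXn2r _ 2) ?nnegrE ?sqrtr_ge0 ?(ltW r0) //.
by rewrite sqr_sqrtr ?rip_ge0.
Qed.

Lemma cauchy_rip v : (forall e : R, 0 < e ->
  exists N, forall n, (N <= n)%N -> rip (v n - v N) (v n - v N) < e) ->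
  cvgn v.
Proof.
move=> cv; apply/cauchy_cvgP/cauchy_exP => e e0.
have [r r0 ->] := gt0_complexP e0.
have [N vN] := cv _ (exprn_gt0 2 r0).
exists (v N); exists N => // n /= /vN t.
rewrite -ball_normE /ball_ /= distrC normrE ltcR.
rewrite -(@ltr_pXn2r _ 2) ?nnegrE ?sqrtr_ge0 ?(ltW r0) //.
by rewrite sqr_sqrtr ?rip_ge0.
Qed.

Lemma cvg_bop T v l : (v n @[n --> \oo] --> l) -> (T (v n) @[n --> \oo] --> T l).
Proof.
move=> /cvg_ripP vl; apply/cvg_ripP.
have [M M0 TM] := bop_rip_bounded T.
have vM : M * rip (v n - l) (v n - l) @[n --> \oo] --> 0.
  by rewrite -(mulr0 M); apply: cvgMl_tmp.
apply: squeeze_cvgr (@cvg_cst _ _ _ _ _) vM.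
by apply: nearW => n; rewrite rip_ge0 -linearB TM.
Qed.

Lemma cvg_rip k v l : (v n @[n --> \oo] --> l) -> (rip k (v n) @[n --> \oo] --> rip k l).
Proof.
move=> /cvg_ripP vl; apply/cvgrPdist_lt => e e0.
have kk : 0 < rip k k + 1 by rewrite ltr_wpDl ?rip_ge0.
have /(cvgrPdist_lt _ _).1 := vl => /(_ (e ^+ 2 / (rip k k + 1))) [].
  by rewrite divr_gt0 // exprn_gt0.
move=> N _ vN; exists N => // n /= /vN.
rewrite sub0r normrN ger0_norm ?rip_ge0 // ltr_pdivlMr // => t.
rewrite distrC -ripBr -(@ltr_pXn2r _ 2) ?nnegrE ?(ltW e0) // real_normK ?num_real //.
apply: le_lt_trans (rip_CS _ _) (le_lt_trans _ t).
by rewrite mulrC ler_wpM2l ?rip_ge0 // lerDl.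
Qed.

(** A uniformly bounded sequence converges strongly as soon as its increments
    are controlled by those of a bounded scalar sequence, which is then
    monotone. *)
Lemma strong_limit (S : nat -> bop H) (M : R) (phi : H -> nat -> R) : 0 <= M ->
  (forall n h, rip (S n h) (S n h) <= M * rip h h) ->
  (forall h m n, (m <= n)%N -> rip (S n h - S m h) (S n h - S m h) <= phi h n - phi h m) ->
  (forall h, exists c, forall n, phi h n <= c) ->
  exists T : bop H, forall h, S n h @[n --> \oo] --> T h.
Proof.
move=> M0 SM Sphi phib.
have cS h : cvgn (S ^~ h).
  apply: cauchy_rip => e e0.
  have nd : nondecreasing_seq (phi h).
    by move=> m n mn; rewrite -subr_ge0 (le_trans _ (Sphi _ _ _ mn)) ?rip_ge0.
  have [c hc] := phib h.
  have ub : has_ubound (range (phi h)) by exists c => _ [n _ <-].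
  have /cvgrPdist_lt/(_ _ e0)[N _ pN] := nondecreasing_cvgn nd ub.
  exists N => n Nn; apply: le_lt_trans (Sphi _ _ _ Nn) _.
  have := pN N (leqnn N); rewrite /= ltr_norml => /andP[_].
  apply: le_lt_trans; rewrite lerB //.
  by apply: ub_le_sup => //; exists n.
pose f h : H := limn (S ^~ h).
have fl : linear f.
  move=> a x y; apply: cvg_lim => //.
  under eq_cvg do rewrite linearP.
  by apply: cvgD; [apply: cvgZl_tmp; exact: cS|exact: cS].
have fb : exists M' : R[i], forall x, `|f x| <= M' * `|x|.
  exists (Num.sqrt M)%:C%C => h; rewrite !normrE -rmorphM lecR.
  rewrite -sqrtrM // ler_wsqrtr //.
  (* 2 <f h, S_n h> <= |f h|^2 + |S_n h|^2 keeps the constant M in the limit. *)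
  have lim2 : rip (f h) (S n h) *+ 2 @[n --> \oo] --> rip (f h) (f h) *+ 2.
    rewrite mulr2n; under eq_cvg do rewrite mulr2n.
    by apply: cvgD; apply: cvg_rip; exact: cS.
  suff : rip (f h) (f h) *+ 2 <= rip (f h) (f h) + M * rip h h by rewrite mulr2n lerD2l.
  apply: (cvgr_to_le lim2); apply: nearW => n.
  have := rip_ge0 (f h - S n h); rewrite !ripE (ripC (S n h) (f h)).
  by have := SM n h; lra.
have fP : f \in bounded_linear_pred by apply/bounded_linearP.
by exists (Bop fP) => h; exact: cS.
Qed.
End StrongLimits.

(** * The commutative ring of self-adjoint elements of a bicommutant *)

Section SelfadjointBicommutant.
Context {R : realType} {H : hilbertType R}.
Context (a : bop H).
Implicit Types (h k : H) (S T : bop H).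

Definition sabic_pred : {pred bop H} :=
  fun T => `[< selfadj T /\ forall S, S * a = a * S -> S * T = T * S >].

Lemma sabic_predP T :
  reflect (selfadj T /\ forall S, S * a = a * S -> S * T = T * S) (T \in sabic_pred).
Proof. exact: asboolP. Qed.

Lemma sabic_pred_comm S T : S \in sabic_pred -> T \in sabic_pred -> S * T = T * S.
Proof. by move=> /sabic_predP[_ Sa] /sabic_predP[_ Ta]; apply/Ta/esym/Sa. Qed.

Lemma sabic_subring_closed : subring_closed sabic_pred.
Proof.
split=> [|S T SP TP|S T SP TP].
- by apply/sabic_predP; split=> // S _; rewrite mulr1 mul1r.
- have [[sS Sa] [sT Ta]] := (sabic_predP _ SP, sabic_predP _ TP).
  apply/sabic_predP; split=> [|U Ua]; first exact: selfadjB.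
  by rewrite mulrBr mulrBl Sa // Ta.
- have [[sS Sa] [sT Ta]] := (sabic_predP _ SP, sabic_predP _ TP).
  apply/sabic_predP; split=> [|U Ua]; first exact/selfadjM/sT/sS/sabic_pred_comm.
  by rewrite mulrA Sa // -!mulrA Ta.
Qed.

HB.instance Definition _ :=
  GRing.isSubringClosed.Build (bop H) sabic_pred sabic_subring_closed.

(** Elements of this type commute with one another and with whatever commutes
    with a, and products of its nonnegative elements are nonnegative. *)
Record sabic := Sabic { sabic_op :> bop H ; _ : sabic_op \in sabic_pred }.

HB.instance Definition _ := [isSub of sabic for sabic_op].
HB.instance Definition _ := [Choice of sabic by <:].
HB.instance Definition _ :=
  GRing.SubChoice_isSubPzRing.Build (bop H) sabic_pred sabic sabic_subring_closed.

Lemma sabic_mulC : commutative (@GRing.mul sabic).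
Proof. by move=> x y; apply/val_inj/sabic_pred_comm; apply: valP. Qed.

HB.instance Definition _ :=
  GRing.PzSemiRing_hasCommutativeMul.Build sabic sabic_mulC.

Implicit Types x y z : sabic.

Lemma sabic_selfadj x : selfadj x.
Proof. by case: x => x /= /sabic_predP[]. Qed.

Lemma sabic_comm x S : S * a = a * S -> S * (x : bop H) = (x : bop H) * S.
Proof. by case: x => x /= /sabic_predP[_ xa] /xa. Qed.

Lemma rsc_subproof (c : R) : c%:C%C *: (1 : bop H) \in sabic_pred.
Proof.
apply/sabic_predP; split=> [|S _]; first exact: selfadjZ.
by rewrite -bop_scalerAr -bop_scalerAl mulr1 mul1r.
Qed.

(** Real scalars, as a ring morphism rather than a scaling, so that they take
    part in commutative ring normalization. *)
Definition rsc (c : R) : sabic := Sabic (rsc_subproof c).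

Lemma rsc_is_zmod_morphism : zmod_morphism rsc.
Proof. by move=> c d; apply: val_inj; rewrite /= rmorphB scalerBl. Qed.

Lemma rsc_is_monoid_morphism : monoid_morphism rsc.
Proof.
split; first by apply: val_inj; rewrite /= rmorph1 scale1r.
by move=> c d; apply: val_inj; rewrite /= rmorphM -bop_scalerAl mul1r scalerA.
Qed.

HB.instance Definition _ := GRing.isZmodMorphism.Build R sabic rsc rsc_is_zmod_morphism.
HB.instance Definition _ := GRing.isMonoidMorphism.Build R sabic rsc rsc_is_monoid_morphism.

Lemma sabicDE x y h : (x + y) h = x h + y h. Proof. by []. Qed.
Lemma sabicNE x h : (- x) h = - x h. Proof. by []. Qed.
Lemma sabicBE x y h : (x - y) h = x h - y h. Proof. by []. Qed.
Lemma sabicME x y h : (x * y) h = x (y h). Proof. by []. Qed.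
Lemma sabic1E h : (1 : sabic) h = h. Proof. by []. Qed.
Lemma rscE c h : rsc c h = c%:C%C *: h. Proof. by []. Qed.
Lemma sabicP x y : (forall h, x h = y h) -> x = y.
Proof. by move=> xy; apply/val_inj/bopP. Qed.

Lemma rip_sabic x h k : rip (x h) k = rip h (x k).
Proof. exact/selfadj_rip/sabic_selfadj. Qed.

Definition spos x := forall h, 0 <= rip h (x h).

Lemma spos_rsc c : 0 <= c -> spos (rsc c).
Proof. by move=> c_ge0 h; rewrite rscE ripZr mulr_ge0 ?rip_ge0. Qed.

Lemma spos1 : spos 1.
Proof. by move=> h; exact: rip_ge0. Qed.

Lemma sposD x y : spos x -> spos y -> spos (x + y).
Proof. by move=> x0 y0 h; rewrite sabicDE ripDr addr_ge0. Qed.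

Lemma spos_sqr x : spos (x * x).
Proof. by move=> h; rewrite sabicME -rip_sabic rip_ge0. Qed.

Lemma sposM x y : spos x -> spos y -> spos (x * y).
Proof.
move=> x0 y0; apply: rip_mul_ge0 => //; first exact: sabic_selfadj.
by apply: sabic_pred_comm; apply: valP.
Qed.

(** Self-adjointness and commutation are closed under strong limits. *)
Lemma sabic_strong_limit (x_ : nat -> sabic) (M : R) (phi : H -> nat -> R) :
  0 <= M ->
  (forall n h, rip (x_ n h) (x_ n h) <= M * rip h h) ->
  (forall h m n, (m <= n)%N ->
     rip (x_ n h - x_ m h) (x_ n h - x_ m h) <= phi h n - phi h m) ->
  (forall h, exists c, forall n, phi h n <= c) ->
  exists x : sabic, forall h, x_ n h @[n --> \oo] --> x h.
Proof.
move=> M0 xM xphi phib.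
have [T xT] := strong_limit (S := fun n => x_ n : bop H) M0 xM xphi phib.
have TP : T \in sabic_pred.
  apply/sabic_predP; split=> [|S Sa].
    apply: rip_selfadjP => h k.
    rewrite ripC.
    have /cvg_lim <- // := @cvg_rip _ _ k _ _ (xT h).
    have /cvg_lim <- // := @cvg_rip _ _ h _ _ (xT k).
    by congr (limn _); apply/funext => n /=; rewrite -rip_sabic ripC.
  apply/bopP => h; rewrite !bopME.
  have /cvg_lim <- // := @cvg_bop _ _ S _ _ (xT h).
  have /cvg_lim <- // := xT (S h).
  by congr (limn _); apply/funext => n /=; rewrite -!bopME (sabic_comm _ Sa).
by exists (Sabic TP).
Qed.

(** Strong convergence is jointly continuous on uniformly bounded sequences;
    this is what allows products to pass to the limit. *)
Lemma cvg_strong_apply (S_ : nat -> bop H) S (M : R) (u_ : H ^nat) (u : H) :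
  (forall n h, rip (S_ n h) (S_ n h) <= M * rip h h) ->
  (forall h, S_ n h @[n --> \oo] --> S h) ->
  u_ n @[n --> \oo] --> u ->
  S_ n (u_ n) @[n --> \oo] --> S u.
Proof.
move=> SM cS cu.
rewrite -[S u]add0r.
have -> : (fun n => S_ n (u_ n)) = (fun n => S_ n (u_ n - u) + S_ n u).
  by apply/funext => n; rewrite linearB subrK.
apply: cvgD; last exact: cS.
apply/cvg_ripP.
have vM : M * rip (u_ n - u) (u_ n - u) @[n --> \oo] --> 0.
  by rewrite -(mulr0 M); apply: cvgMl_tmp; exact/cvg_ripP.
apply: squeeze_cvgr (@cvg_cst _ _ _ _ _) vM.
by apply: nearW => n; rewrite subr0 rip_ge0 SM.
Qed.

(** * The sign of a self-adjoint contraction *)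

Definition half := rsc 2^-1.
Lemma halfD : half + half = 1.
Proof.
rewrite /half -rmorphD; have -> : 2^-1 + 2^-1 = 1 :> R by lra.
exact: rmorph1.
Qed.
Lemma half_pos : spos half.
Proof. by apply: spos_rsc; rewrite invr_ge0. Qed.
#[local] Hint Resolve half_pos : core.

Section Sign.
Context (b : sabic) (b1 : spos (1 - b)) (b2 : spos (1 + b)).

(** The Newton-Schulz iteration for the sign function: on the open interval
    ]-1, 1[ it is odd, increasing and moves every nonzero point away from 0. *)
Fixpoint sgn_seq n :=
  if n is n'.+1 then half * (sgn_seq n' * (3 - sgn_seq n' * sgn_seq n')) else b.

Lemma sgn_seqS n : sgn_seq n.+1 = half * (sgn_seq n * (3 - sgn_seq n * sgn_seq n)).
Proof. by []. Qed.

(** 1 - x (3 - x^2) / 2 = (1 - x)^2 (2 + x) / 2, and symmetrically. *)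
Lemma sgn_seq_bound n : spos (1 - sgn_seq n) /\ spos (1 + sgn_seq n).
Proof.
elim: n => [//|n]; rewrite sgn_seqS; move: (sgn_seq n) => x [x1 x2]; split.
- have -> : 1 - half * (x * (3 - x * x)) = half * (((1 - x) * (1 - x)) * (1 + (1 + x))).
    by rewrite -{1}halfD; ring.
  by apply: sposM => //; apply: sposM; [exact: spos_sqr|exact/sposD/x2/spos1].
- have -> : 1 + half * (x * (3 - x * x)) = half * (((1 + x) * (1 + x)) * (1 + (1 - x))).
    by rewrite -{1}halfD; ring.
  by apply: sposM => //; apply: sposM; [exact: spos_sqr|exact/sposD/x1/spos1].
Qed.

Lemma sgn_seq_sqr n : spos (1 - sgn_seq n * sgn_seq n).
Proof.
have [x1 x2] := sgn_seq_bound n.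
have -> : 1 - sgn_seq n * sgn_seq n = (1 - sgn_seq n) * (1 + sgn_seq n) by ring.
exact: sposM.
Qed.

(** The iterates keep their sign and grow in absolute value: each step adds
    x_m x_n (1 - x_n^2) / 2 >= 0 to x_m x_n. *)
Lemma sgn_seq_mono m n : (m <= n)%N -> spos (sgn_seq m * sgn_seq n - sgn_seq m * sgn_seq m).
Proof.
move=> mn; rewrite -(subnKC mn); elim: (n - m)%N => [|k IHk].
  by rewrite addn0 subrr => h; rewrite ripr0.
rewrite addnS sgn_seqS; set x := sgn_seq m in IHk *; set y := sgn_seq (m + k) in IHk *.
have -> : x * (half * (y * (3 - y * y))) - x * x =
    (x * y - x * x) + half * (((x * y - x * x) + x * x) * (1 - y * y)) +
    (half + half - 1) * (x * y) by ring.
rewrite halfD subrr mul0r addr0; apply: sposD => //; apply: sposM => //.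
by apply: sposM; [exact/sposD/spos_sqr|exact: sgn_seq_sqr].
Qed.

Lemma sgn_seq_contr n h : rip (sgn_seq n h) (sgn_seq n h) <= rip h h.
Proof.
by have := sgn_seq_sqr n h; rewrite sabicBE ripBr sabicME subr_ge0 -rip_sabic.
Qed.

(** By monotonicity (x_n - x_m)^2 <= x_n^2 - x_m^2, so the iterates converge
    strongly, and the limit is a fixed point of the iteration. *)
Lemma sign_exists : exists x : sabic, x * x * x = x /\ spos (b * x - b * b).
Proof.
pose phi h n := rip (sgn_seq n h) (sgn_seq n h).
have [x cx] : exists x : sabic, forall h, sgn_seq n h @[n --> \oo] --> x h.
  apply: (@sabic_strong_limit _ 1 phi) => // [n h|h m n mn|h].
  - by rewrite mul1r sgn_seq_contr.
  - have := sgn_seq_mono mn h; rewrite sabicBE !sabicME ripBr.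
    rewrite -(rip_sabic _ h (sgn_seq n h)) -(rip_sabic _ h (sgn_seq m h)) => t.
    by rewrite /phi !ripE (ripC (sgn_seq n h)); lra.
  - by exists (rip h h) => n; exact: sgn_seq_contr.
exists x; split.
  have x2 : x * (3 - x * x) = x + x.
    apply: sabicP => h.
    have l1 : (sgn_seq n.+1 h + sgn_seq n.+1 h) @[n --> \oo] --> x h + x h.
      have := cx h; rewrite -cvg_shiftS => t; exact: cvgD.
    have l2 : (sgn_seq n h *+ 3 - sgn_seq n (sgn_seq n (sgn_seq n h))) @[n --> \oo] -->
        x h *+ 3 - x (x (x h)).
      have xM n k : rip (sgn_seq n k) (sgn_seq n k) <= 1 * rip k k by rewrite mul1r sgn_seq_contr.
      apply: cvgB; first exact: cvgMn.
      by do 2!(apply: (cvg_strong_apply (S_ := fun n => sgn_seq n : bop H) xM) => //).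
    have cube y : (y * (3 - y * y)) h = y h *+ 3 - y (y (y h)).
      have -> : y * (3 - y * y) = y + y + y - y * (y * y) by ring.
      by rewrite mulrSr mulr2n.
    have double n : sgn_seq n h *+ 3 - sgn_seq n (sgn_seq n (sgn_seq n h)) =
        sgn_seq n.+1 h + sgn_seq n.+1 h.
      by rewrite -cube sgn_seqS -sabicDE -mulrDl halfD mul1r.
    rewrite cube (sabicDE x x).
    have /cvg_lim <- // := l2.
    have /cvg_lim <- // := l1.
    by congr (limn _); apply/funext => n; exact: double.
  have -> : x * x * x = x * (3 - x * x) *- 1 + 3 * x by ring.
  by rewrite x2; ring.
move=> h; rewrite sabicBE !sabicME ripBr subr_ge0.
have bx : rip (b h) (sgn_seq n h) @[n --> \oo] --> rip h (b (x h)).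
  by rewrite -rip_sabic; exact: cvg_rip.
apply: (cvgr_to_ge bx); apply: nearW => n.
have := @sgn_seq_mono 0 n (leq0n n) h.
by rewrite sabicBE !sabicME ripBr subr_ge0 -(rip_sabic _ h (sgn_seq n h)).
Qed.

(** The sign x of b takes the values -1, 0 and 1, so (x^2 + x) / 2 is the
    projection onto its eigenvalue 1; b vanishes where x does, because
    (b (1 - x^2))^2 <= b x (1 - x^2)^2 = 0. *)
Lemma cut_exists : exists P : sabic, [/\ P * P = P, spos (P * b) & spos ((1 - P) * - b)].
Proof.
have [x [x3 bx]] := sign_exists.
have bx0 : spos (b * x).
  have -> : b * x = (b * x - b * b) + b * b by ring.
  exact/sposD/spos_sqr.
have idem y : y * y * y = y -> half * (y * y + y) * (half * (y * y + y)) = half * (y * y + y).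
  move=> y3.
  have -> : half * (y * y + y) * (half * (y * y + y)) =
    half * ((half + half) * (y * y + y) + half * ((y * y * y - y) * (y + 2))) by ring.
  by rewrite y3 subrr mul0r mulr0 addr0 halfD mul1r.
have iP := idem x x3.
have /idem iQ : (- x) * (- x) * (- x) = - x by rewrite !mulrNN mulrN x3.
have Px : x * (half * (x * x + x)) = half * (x * x + x).
  have -> : x * (half * (x * x + x)) = half * (x * x * x + x * x) by ring.
  by rewrite x3 addrC.
have Qx : x * (half * (- x * - x + - x)) = - (half * (- x * - x + - x)).
  have -> : x * (half * (- x * - x + - x)) = half * (x * x * x - x * x) by ring.
  by rewrite x3; ring.
(* 1 - x^2 is the projection onto the kernel of x. *)
have N0 : b * (1 - x * x) = 0.
  apply: sabicP => h; apply/eqP; rewrite -rip_eq0 eq_le rip_ge0 andbT.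
  rewrite rip_sabic -sabicME.
  have := bx ((1 - x * x) h).
  rewrite rip_sabic -!sabicME.
  have -> : (1 - x * x) * (b * x - b * b) * (1 - x * x) =
     - ((b * (1 - x * x)) * (b * (1 - x * x))) + b * (x - x * x * x) * (1 - x * x) by ring.
  by rewrite x3 subrr mulr0 mul0r addr0 sabicNE ripNr oppr_ge0.
exists (half * (x * x + x)); split => //.
- have -> : half * (x * x + x) * b = half * (x * x + x) * (b * x) +
      (half * (x * x + x) - x * (half * (x * x + x))) * b by ring.
  rewrite Px subrr mul0r addr0; apply: sposM => //.
  by rewrite -iP; exact: spos_sqr.
- set Q := half * (- x * - x + - x) in iQ Qx.
  have -> : (1 - half * (x * x + x)) * - b =
      Q * (b * x) - b * (1 - x * x) - (Q + x * Q) * b +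
      (half + half - 1) * (b * x * x) by rewrite /Q; ring.
  rewrite N0 Qx subrr halfD subrr !mul0r !subr0 addr0; apply: sposM => //.
  by rewrite -iQ; exact: spos_sqr.
Qed.

End Sign.

(** The inverse of 1 - u >= s is the sum of the powers of u.  The partial sums
    W_n increase and are at most 1 / s, so that
    s (W_n - W_m)^2 <= W_n - W_m for m <= n. *)
Lemma neumann (s : R) (u : sabic) : 0 < s -> spos u -> spos (rsc (1 - s) - u) ->
  exists W : sabic, [/\ (1 - u) * W = 1, spos W & spos (1 - rsc s * W)].
Proof.
move=> s0 u0 us.
pose fix W_ n : sabic := if n is n'.+1 then 1 + u * W_ n' else 0.
have WS n : W_ n.+1 = 1 + u * W_ n by [].
have W0 n : spos (W_ n).
  elim: n => [h|n IHn]; first by rewrite ripr0.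
  by apply: sposD; [exact: spos1|exact: sposM].
have sW n : spos (1 - rsc s * W_ n).
  elim: n => [|n IHn]; first by rewrite mulr0 subr0; exact: spos1.
  rewrite WS; have -> : 1 - rsc s * (1 + u * W_ n) =
    (rsc (1 - s) - u) + u * (1 - rsc s * W_ n) by rewrite rmorphB rmorph1; ring.
  by apply: sposD => //; exact: sposM.
have Wmono m n : (m <= n)%N -> spos (W_ n - W_ m).
  have Wn (k : nat) : spos (W_ k.+1 - W_ k).
    elim: k => [|k IHk]; first by rewrite WS subr0 mulr0 addr0; exact: spos1.
    have -> : W_ k.+2 - W_ k.+1 = u * (W_ k.+1 - W_ k) by rewrite !WS; ring.
    exact: sposM.
  move=> mn; rewrite -(subnKC mn); elim: (n - m)%N => [|k IHk].
    by rewrite addn0 subrr => h; rewrite ripr0.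
  rewrite addnS.
  have -> : W_ (m + k).+1 - W_ m = (W_ (m + k).+1 - W_ (m + k)%N) + (W_ (m + k)%N - W_ m) by ring.
  exact: sposD.
have WD h m n : (m <= n)%N -> rip (W_ n h - W_ m h) (W_ n h - W_ m h) <=
    s^-1 * rip h (W_ n h) - s^-1 * rip h (W_ m h).
  move=> mn; rewrite -mulrBr ler_pdivlMl // -subr_ge0 -ripBr -sabicBE.
  rewrite rip_sabic -sabicME -ripZr -rscE -ripBr -!sabicME -sabicBE.
  have -> : W_ n - W_ m - rsc s * ((W_ n - W_ m) * (W_ n - W_ m)) =
    (W_ n - W_ m) * ((1 - rsc s * W_ n) + rsc s * W_ m) by ring.
  apply: sposM; first exact: Wmono.
  by apply: sposD => //; apply: sposM => //; apply/spos_rsc/ltW.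
have Ws n h : rip h (W_ n h) <= s^-1 * rip h h.
  by rewrite ler_pdivlMl // -subr_ge0 -ripZr -rscE -{1}(sabic1E h) -ripBr; exact: sW.
have [W cW] : exists W : sabic, forall h, W_ n h @[n --> \oo] --> W h.
  apply: (@sabic_strong_limit W_ (s^-1 * s^-1) (fun h n => s^-1 * rip h (W_ n h))) => // [|n h|h].
  - by rewrite mulr_ge0 // invr_ge0 ltW.
  - have := WD h 0%N n (leq0n n); rewrite subr0 ripr0 mulr0 subr0 => t.
    by apply: le_trans t _; rewrite -mulrA ler_wpM2l // invr_ge0 ltW.
  - by exists (s^-1 * (s^-1 * rip h h)) => n; rewrite ler_wpM2l // invr_ge0 ltW.
exists W; split.
- apply/eqP; rewrite mulrBl mul1r subr_eq; apply/eqP; apply: sabicP => h.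
  have l1 : W_ n.+1 h @[n --> \oo] --> W h by have := cW h; rewrite -cvg_shiftS.
  have l2 : h + u (W_ n h) @[n --> \oo] --> h + u (W h).
    by apply: cvgD; [exact: cvg_cst|exact: cvg_bop].
  rewrite sabicDE sabicME sabic1E.
  have /cvg_lim <- // := l2.
  by have /cvg_lim <- // := l1.
- move=> h; apply: (cvgr_to_ge (cvg_rip (cW h))); apply: nearW => n; exact: W0.
- move=> h; rewrite sabicBE ripBr sabicME rscE ripZr sabic1E subr_ge0 -ler_pdivlMl //.
  by apply: (cvgr_to_le (cvg_rip (cW h))); apply: nearW.
Qed.

(** P is the spectral projection of t for a cut at s, and C the inverse of t on
    the range of P, extended by 0. *)
Lemma spectral_cut (s : R) (t : sabic) : 0 < s < 1 -> spos t -> spos (1 - t) ->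
  exists P C : sabic, [/\ P * P = P, P * C = C & t * C = P] /\
    [/\ spos C, spos (P - rsc s * C) & spos ((1 - P) * (rsc s - t))].
Proof.
move=> /andP[s0 s1] t0 t1.
have [] := @cut_exists (t - rsc s).
- have -> : 1 - (t - rsc s) = (1 - t) + rsc s by ring.
  by apply: sposD => //; exact/spos_rsc/ltW.
- have -> : 1 + (t - rsc s) = t + rsc (1 - s) by rewrite rmorphB rmorph1; ring.
  by apply: sposD => //; apply: spos_rsc; rewrite subr_ge0 ltW.
move=> P [PP Pb Qb].
have P0 : spos P by rewrite -PP; exact: spos_sqr.
have Q0 : spos (1 - P).
  have -> : 1 - P = (1 - P) * (1 - P) + (P - P * P) by ring.
  by rewrite PP subrr addr0; exact: spos_sqr.
(* 1 - P (1 - t) is t on the range of P and 1 on its complement. *)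
have [||W [uW W0 sW]] := @neumann s (P * (1 - t)) s0.
- exact: sposM.
- have -> : rsc (1 - s) - P * (1 - t) = rsc (1 - s) * (1 - P) + P * (t - rsc s).
    by rewrite rmorphB rmorph1; ring.
  by apply: sposD => //; apply: sposM => //; apply: spos_rsc; rewrite subr_ge0 ltW.
exists P, (P * W); split; split => //.
- by rewrite mulrA PP.
- rewrite -[RHS]mulr1 -uW.
  have -> : P * ((1 - P * (1 - t)) * W) = P * W - P * P * W + t * (P * P * W) by ring.
  by rewrite PP subrr add0r.
- exact: sposM.
- have -> : P - rsc s * (P * W) = P * (1 - rsc s * W) by ring.
  exact: sposM.
- by rewrite -(opprB t).
Qed.

(** * Operators that are scalar on each side of a cut *)

Implicit Types (P C t : sabic) (p q s : R).

Definition step_op P p q : sabic := rsc p * (1 - P) + rsc q * P.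

Lemma step_opM P p q p' q' : P * P = P ->
  step_op P p q * step_op P p' q' = step_op P (p * p') (q * q').
Proof.
move=> PP; rewrite /step_op !rmorphM.
set x := rsc p; set y := rsc q; set x' := rsc p'; set y' := rsc q'.
have -> : (x * (1 - P) + y * P) * (x' * (1 - P) + y' * P) =
   x * x' * (1 - P) + y * y' * P + (x - y) * (x' - y') * (P * P - P) by ring.
by rewrite PP subrr mulr0 addr0.
Qed.

Lemma step_op_scalar P p : step_op P p p = rsc p.
Proof. by rewrite /step_op; ring. Qed.

Lemma step_opD P p q p' q' : step_op P p q + step_op P p' q' = step_op P (p + p') (q + q').
Proof. by rewrite /step_op !rmorphD; ring. Qed.

Lemma step_op_absorb P C p q : P * C = C -> step_op P p q * C = rsc q * C.
Proof.
move=> PC; have -> : step_op P p q * C = rsc p * (C - P * C) + rsc q * (P * C).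
  by rewrite /step_op; ring.
by rewrite PC subrr mulr0 add0r.
Qed.

(** When C inverts t on the range of P, this is l + (1 - l) / t there, and 1 on
    the orthogonal complement. *)
Definition tilt_weight P C l : sabic := step_op P 1 l + rsc (1 - l) * C.

(** l P + (1 - l) C = l (P - s C) + (1 - l (1 - s)) C. *)
Lemma tilt_weight_pos P C l s : 0 <= l -> l * (1 - s) <= 1 ->
  P * P = P -> spos C -> spos (P - rsc s * C) -> spos (tilt_weight P C l).
Proof.
move=> l0 ls PP C0 PC.
have -> : tilt_weight P C l = (1 - P) * (1 - P) + rsc l * (P - rsc s * C) +
     rsc (1 - l * (1 - s)) * C + (P - P * P).
  by rewrite /tilt_weight /step_op !(rmorphB, rmorphM) rmorph1; ring.
rewrite PP subrr addr0; apply: sposD.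
  by apply: sposD; [exact: spos_sqr|apply: sposM => //; exact: spos_rsc].
by apply: sposM => //; apply: spos_rsc; rewrite subr_ge0.
Qed.

Lemma tilt_weights_sum1 P C t l m : P * P = P -> t * C = P -> m * m = l ->
  tilt_weight P C l * t + step_op P 1 m * (1 - t) * step_op P 1 m = 1.
Proof.
move=> PP tC <-.
have -> : tilt_weight P C (m * m) * t + step_op P 1 m * (1 - t) * step_op P 1 m =
    step_op P 1 (m * m) * t + rsc (1 - m * m) * (t * C) +
    (step_op P 1 m * step_op P 1 m) * (1 - t) by rewrite /tilt_weight; ring.
by rewrite step_opM // tC mul1r /step_op !(rmorphB, rmorphM) rmorph1; ring.
Qed.

(** For l = s the tilted effect g is t <= s off the range of P, and 1 - g is
    s (1 - t) <= s on it. *)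
Lemma tilted_effect_sub_sqr_le P C t s :
  P * P = P -> t * C = P -> 0 <= s -> spos t -> spos (1 - t) ->
  spos ((1 - P) * (rsc s - t)) ->
  spos (rsc s - (tilt_weight P C s * t - tilt_weight P C s * t * (tilt_weight P C s * t))).
Proof.
move=> PP tC s0 t0 t1 cut.
set r := rsc s.
have r0 : spos r by exact: spos_rsc.
have -> : tilt_weight P C s * t = (1 - P) * t + (1 - r * (1 - t)) * P.
  have -> : tilt_weight P C s * t = step_op P 1 s * t + rsc (1 - s) * (t * C).
    by rewrite /tilt_weight; ring.
  by rewrite tC /step_op rmorphB rmorph1 /r; ring.
have P0 : spos P by rewrite -PP; exact: spos_sqr.
set g := _ + _ * P.
(* The last two lines vanish because P is idempotent; they make the identity
   hold in the polynomial ring. *)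
have -> : r - (g - g * g) = (1 - P) * (r - t) + ((1 - P) * t) * ((1 - P) * t) +
    r * (P * t) + (r * (1 - t)) * (r * (1 - t)) * P
    + (t - (1 - r * (1 - t))) * (t - (1 - r * (1 - t))) * (P * P - P)
    + (t * t) * (P - P * P).
  by rewrite /g; ring.
rewrite PP subrr !mulr0 !addr0.
apply: sposD; last by apply: sposM => //; exact: spos_sqr.
apply: sposD; last by do 2!apply: sposM => //.
by apply: sposD => //; exact: spos_sqr.
Qed.

(** For two pairs (p, q) with squares adding up to 1, the right-hand sides
    add up to 1: the C terms cancel. *)
Lemma step_op_conj_weight P C p q : P * P = P -> P * C = C -> q != 0 ->
  step_op P p q * tilt_weight P C (p ^+ 2 / q ^+ 2) * step_op P p q =
  rsc (p ^+ 2) + rsc (q ^+ 2 - p ^+ 2) * C.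
Proof.
move=> PP PC q0.
rewrite mulrAC step_opM // /tilt_weight mulrDr step_opM // !mulr1.
have -> : q * q * (p ^+ 2 / q ^+ 2) = p * p by field.
rewrite step_op_scalar; congr (_ + _).
rewrite mulrCA step_op_absorb // mulrA -rmorphM; congr (rsc _ * _).
by field.
Qed.

Lemma step_op_ratio P p q : P * P = P -> q != 0 -> step_op P p q * step_op P 1 (p / q) = rsc p.
Proof.
move=> PP q0; rewrite step_opM // mulr1; have -> : q * (p / q) = p by field.
by rewrite step_op_scalar.
Qed.

Lemma spos_sub_sqr t : spos t -> spos (1 - t) -> spos (t - t * t).
Proof.
move=> t0 t1; have -> : t - t * t = t * (1 - t) by ring.
exact: sposM.
Qed.

End SelfadjointBicommutant.

(** * Finite additivity and tilting of a POVM *)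

Section PovmFacts.
Context {d : measure_display} {X : measurableType d}.
Context {R : realType} {H : hilbertType R}.
Implicit Types (m : set X -> R[i]) (mu : set X -> bop H).

Lemma complex_measure0 m : complex_measure m -> m set0 = 0.
Proof.
move=> cm.
have := cm (fun=> set0) (fun=> measurable0) (@trivIset_set0 _ _ setT).
move=> /cvgP/cvg_series_cvg_0/cvg_lim <- //.
by rewrite lim_cst.
Qed.

Lemma complex_measureU m A B : complex_measure m -> measurable A -> measurable B ->
  A `&` B = set0 -> m (A `|` B) = m A + m B.
Proof.
move=> cm mA mB AB.
have mAB n : measurable (bigcup2 A B n) by case: n => [|[|n]] //=.
have := AB; rewrite trivIset_bigcup2 => /(cm _ mAB); rewrite bigcup2E => l.
have l2 : (fun n => \sum_(0 <= j < n) m (bigcup2 A B j) : R[i]^o) @ \oo -->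
    (m A + m B : R[i]^o).
  apply: cvg_near_cst.
  exists 2%N => // n /= n2; rewrite (big_cat_nat (n := 2)) //= big_nat_recr //= big_nat1.
  rewrite big_nat_cond big1 ?addr0 // => -[|[|j]]; rewrite ?andbT //= => _.
  exact: complex_measure0.
by rewrite -(cvg_lim _ l) // -(cvg_lim _ l2).
Qed.

Lemma complex_measureI m D : measurable D -> complex_measure m ->
  complex_measure (fun A => m (A `&` D)).
Proof.
move=> mD cm A mA tA; rewrite setI_bigcupl; apply: cm => [n|].
  exact: measurableI.
exact: trivIset_setIr.
Qed.

Lemma complex_measureD m1 m2 : complex_measure m1 -> complex_measure m2 ->
  complex_measure (fun A => m1 A + m2 A).
Proof.
move=> c1 c2 A mA tA.
under eq_cvg do rewrite big_split.
exact: cvgD (c1 A mA tA) (c2 A mA tA).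
Qed.

Lemma povmU mu A B : povm mu -> measurable A -> measurable B -> A `&` B = set0 ->
  mu (A `|` B) = mu A + mu B.
Proof.
move=> [_ cmu] mA mB AB; apply/bopP => h; apply: rip_inj => l.
by rewrite bopDE ripDr /rip (complex_measureU (cmu l h)) // raddfD.
Qed.

Lemma povm0 mu : povm mu -> mu set0 = 0.
Proof.
move=> [_ cmu]; apply/bopP => h; apply: rip_inj => l.
by rewrite /rip (complex_measure0 (cmu l h)) bop0E -/(rip l 0) ripr0.
Qed.

Lemma povmC mu E : normalized_povm mu -> measurable E -> mu (~` E) = 1 - mu E.
Proof.
move=> [pmu mu1] mE; rewrite -mu1 -(setUv E) povmU ?setICr //; last exact: measurableC.
by rewrite addrC addKr.
Qed.

Lemma povm_split mu A E : povm mu -> measurable A -> measurable E ->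
  mu A = mu (A `&` E) + mu (A `&` ~` E).
Proof.
move=> pmu mA mE; rewrite -povmU //.
- by rewrite -setIUr setUv setIT.
- exact: measurableI.
- by apply: measurableI => //; exact: measurableC.
- by rewrite setIACA setICr setI0.
Qed.

Lemma positive_opM S T : positive_op S -> positive_op T -> S * T = T * S ->
  @positive_op R H (S * T).
Proof.
move=> /positive_opP[sS S0] /positive_opP[sT T0] ST.
by apply/positive_opP; split; [exact: selfadjM|exact: rip_mul_ge0].
Qed.

Lemma positive_op_conj S T : selfadj S -> positive_op T -> @positive_op R H (S * T * S).
Proof. by move=> sS T0 h; rewrite !bopME -sS. Qed.

Lemma positive_opD S T : positive_op S -> positive_op T -> @positive_op R H (S + T).
Proof. by move=> S0 T0 h; rewrite bopDE innerDr addr_ge0. Qed.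

Definition tilt mu E (K M : bop H) (A : set X) : bop H :=
  K * mu (A `&` E) + M * mu (A `&` ~` E) * M.

(** K mu(A & E) is positive as a product of commuting positive operators, and
    countable additivity is inherited from mu by moving K and M to the other
    side of the inner product. *)
Lemma tilt_povm mu E K M : povm mu -> measurable E ->
  positive_op K ->
  (forall A, measurable A -> A `<=` E -> K * mu A = mu A * K) ->
  selfadj M ->
  K * mu E + M * mu (~` E) * M = 1 ->
  normalized_povm (tilt mu E K M).
Proof.
move=> [pmu cmu] mE K0 Kmu sM KM1; split; last by rewrite /tilt !setTI.
have mEC := measurableC mE.
split=> [A mA|h k].
  apply: positive_opD.
    apply: positive_opM => //; first exact/pmu/measurableI.
    by apply: Kmu; [exact: measurableI|exact: subIsetr].
  by apply: positive_op_conj => //; exact/pmu/measurableI.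
have -> : (fun A => inner h (tilt mu E K M A k)) =
    (fun A => inner (K h) (mu (A `&` E) k) + inner (M h) (mu (A `&` ~` E) (M k))).
  apply/funext => A; rewrite /tilt bopDE innerDr !bopME sM.
  by rewrite (positive_selfadj K0).
apply: (complex_measureD (complex_measureI mE (cmu (K h) k))).
exact: (complex_measureI mEC (cmu (M h) (M k))).
Qed.

End PovmFacts.

(** * Unitary conjugation *)

Section Unitaries.
Context {R : realType} {H : hilbertType R}.

(** If no adjoint existed, [adj U] would be the default value 0, so that 1 = 0
    and H would be the zero space. *)
Lemma unitary_adj (U : bop H) : unitary U -> forall h k, inner (adj U h) k = inner h (U k).
Proof.
move=> [UU _] h k.
have [[V UV]|noadj] := pselect (exists V : bop H, forall h k, inner (V h) k = inner h (U k)).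
  by rewrite (adjP UV).
have adj0 : adj U = 0 by rewrite /adj; case: xgetP => // V _ UV; case: noadj; exists V.
have z (v : H) : v = 0 by rewrite -[v]bop1E -UU adj0 mul0r.
by rewrite (z (adj U h)) (z (U k)) (z h) (z k).
Qed.

Lemma conj_sub_sqr (V W G : bop H) h : V * W = 1 ->
  (W * G * V) h - (W * G * V) ((W * G * V) h) = W (G (V h) - G (G (V h))).
Proof.
move=> VW; have VWK k : V (W k) = k by rewrite -bopME VW.
by rewrite !bopME VWK linearB.
Qed.

End Unitaries.

(** * The C*-convex decomposition of an extreme POVM *)

Section ExtremeDecomposition.
Context {d : measure_display} {X : measurableType d}.
Context {R : realType} {H : hilbertType R}.
Context (mu : set X -> bop H) (E : set X) (pmu : normalized_povm mu) (mE : measurable E).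
Local Notation a := (mu E).

Lemma effect_subproof : a \in sabic_pred a.
Proof.
apply/sabic_predP; split=> // .
by apply: positive_selfadj; case: pmu => -[p _] _; exact: p.
Qed.

Definition effect : sabic a := Sabic effect_subproof.

Lemma effectE : effect = mu E :> bop H. Proof. by []. Qed.

Lemma effect_pos : spos effect.
Proof. by case: pmu => -[p _] _ h; have /positive_opP[_] := p E mE; exact. Qed.

Lemma effect_le1 : spos (1 - effect).
Proof.
case: pmu => -[p _] _ h; have /positive_opP[_] := p _ (measurableC mE).
by rewrite (povmC pmu mE); exact.
Qed.

Context (muE : forall A, measurable A -> A `<=` E -> mu A * a = a * mu A).
Context (P C : sabic a) (s : R) (s01 : 0 < s < 1).
Context (PP : P * P = P) (PC : P * C = C) (tC : effect * C = P).
Context (C0 : spos C) (CP : spos (P - rsc a s * C)).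
Context (Pt : spos ((1 - P) * (rsc a s - effect))).

Lemma sabic_positive (x : sabic a) : spos x -> positive_op x.
Proof. by move=> x0; apply/positive_opP; split=> //; exact: sabic_selfadj. Qed.

Lemma tilt_step_normalized (p q : R) : 0 < p -> 0 < q -> p ^+ 2 * (1 - s) <= q ^+ 2 ->
  normalized_povm (tilt mu E (tilt_weight P C (p ^+ 2 / q ^+ 2)) (step_op P 1 (p / q))).
Proof.
move=> p0 q0 pq; apply: tilt_povm => //; first by case: pmu.
- apply: sabic_positive; apply: (@tilt_weight_pos _ _ _ _ _ _ s) => //.
    by rewrite divr_ge0 // exprn_ge0 // ltW.
  by rewrite mulrAC ler_pdivrMr ?mul1r // exprn_gt0.
- by move=> A mA AE; apply/esym/sabic_comm; exact: muE.
- exact: sabic_selfadj.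
- rewrite (povmC pmu mE).
  have := @tilt_weights_sum1 _ _ _ P C effect (p ^+ 2 / q ^+ 2) (p / q) PP tC.
  rewrite -expr2 expr_div_n => /(_ erefl) /(congr1 (@sabic_op _ _ a)).
  exact.
Qed.

(** One term T nu A T of the decomposition: it differs from a multiple of mu A
    only by a multiple of C mu(A & E). *)
Lemma step_op_conj_tilt (p q : R) A : 0 < p -> 0 < q -> measurable A ->
  (step_op P p q : bop H) *
    tilt mu E (tilt_weight P C (p ^+ 2 / q ^+ 2)) (step_op P 1 (p / q)) A *
    (step_op P p q : bop H) =
  (rsc a (p ^+ 2) : bop H) * mu A +
    ((rsc a (q ^+ 2 - p ^+ 2) * C : sabic a) : bop H) * mu (A `&` E).
Proof.
move=> p0 q0 mA; have mEC := measurableC mE.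
have q1 : q != 0 by rewrite gt_eqF.
set T := step_op P p q; set K := tilt_weight _ _ _; set M := step_op P 1 _.
have TKT : T * K * T = rsc a (p ^+ 2) + rsc a (q ^+ 2 - p ^+ 2) * C.
  exact: step_op_conj_weight.
have TM : T * M = rsc a p by exact: step_op_ratio.
have muAE : mu (A `&` E) * (T : bop H) = (T : bop H) * mu (A `&` E).
  by apply: sabic_comm; apply: muE; [exact: measurableI|exact: subIsetr].
have expand (t k m x y : bop H) : t * (k * x + m * y * m) * t =
    t * k * (x * t) + t * m * y * (m * t).
  by rewrite mulrDr mulrDl !mulrA.
rewrite /tilt expand muAE.
have -> : (T : bop H) * (K : bop H) * ((T : bop H) * mu (A `&` E)) =
    ((T * K * T : sabic a) : bop H) * mu (A `&` E) by rewrite mulrA.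
have -> : (M : bop H) * (T : bop H) = (M * T : sabic a) by [].
have -> : (T : bop H) * (M : bop H) = (T * M : sabic a) by [].
rewrite TKT (mulrC M) TM (povm_split pmu.1 mA mE).
have pp (y : bop H) :
    (rsc a p : bop H) * y * (rsc a p : bop H) = (rsc a (p ^+ 2) : bop H) * y.
  by rewrite /= -!bop_scalerAl !mul1r -bop_scalerAr mulr1 scalerA -expr2 rmorphXn.
have distr (r c x y : bop H) : (r + c) * x + r * y = r * (x + y) + c * x.
  by rewrite mulrDl mulrDr addrAC.
by rewrite pp distr.
Qed.

Lemma step_op_invertible (p q : R) : p != 0 -> q != 0 -> invertible (step_op P p q : bop H).
Proof.
move=> p0 q0; exists (step_op P p^-1 q^-1 : bop H); split.
  have : step_op P p^-1 q^-1 * step_op P p q = 1.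
    by rewrite step_opM // !mulVf // step_op_scalar rmorph1.
  by move/(congr1 (@sabic_op _ _ a)).
have : step_op P p q * step_op P p^-1 q^-1 = 1.
  by rewrite step_opM // !mulfV // step_op_scalar rmorph1.
by move/(congr1 (@sabic_op _ _ a)).
Qed.

(** The squares of the two pairs (p, q) are s^2 / 2, s / 2 and their complements
    to 1.  The first pair tilts with l = s, and C*-extremality makes the tilted
    effect unitarily equivalent to mu E. *)
Lemma effect_sub_sqr_le h : cstar_extreme mu ->
  rip h ((effect - effect * effect) h) <= s * rip h h.
Proof.
move=> cmu; have [s0 s1] := andP s01.
pose d1 : R := s ^+ 2 / 2; pose e1 : R := s / 2.
have d10 : 0 < d1 by rewrite divr_gt0 // exprn_gt0.
have e10 : 0 < e1 by rewrite divr_gt0.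
have d11 : 0 < 1 - d1 by rewrite /d1; nra.
have e11 : 0 < 1 - e1 by rewrite /e1; lra.
pose p (i : 'I_2) := Num.sqrt (if i == ord0 then d1 else 1 - d1).
pose q (i : 'I_2) := Num.sqrt (if i == ord0 then e1 else 1 - e1).
have p0 i : 0 < p i by rewrite sqrtr_gt0; case: ifP.
have q0 i : 0 < q i by rewrite sqrtr_gt0; case: ifP.
have p2 i : p i ^+ 2 = if i == ord0 then d1 else 1 - d1.
  by rewrite sqr_sqrtr //; case: ifP => _; rewrite ltW.
have q2 i : q i ^+ 2 = if i == ord0 then e1 else 1 - e1.
  by rewrite sqr_sqrtr //; case: ifP => _; rewrite ltW.
have pq i : p i ^+ 2 * (1 - s) <= q i ^+ 2.
  by rewrite p2 q2; case: ifP => _; rewrite /d1 /e1; nra.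
pose nu (i : 'I_2) :=
  tilt mu E (tilt_weight P C (p i ^+ 2 / q i ^+ 2)) (step_op P 1 (p i / q i)).
pose T (i : 'I_2) : bop H := step_op P (p i) (q i).
have adjT i : adj (T i) = T i by apply/selfadj_adj/sabic_selfadj.
have [] := cmu.2 _ nu T.
- by move=> i; exact: tilt_step_normalized.
- by move=> i; apply: step_op_invertible; rewrite gt_eqF.
- under eq_bigr do rewrite adjT.
  rewrite big_ord_recl big_ord1.
  set j := lift ord0 ord0.
  have : step_op P (p ord0) (q ord0) * step_op P (p ord0) (q ord0) +
      step_op P (p j) (q j) * step_op P (p j) (q j) = 1.
    by rewrite !step_opM // -!expr2 !p2 !q2 step_opD /= !subrKC step_op_scalar rmorph1.
  by move/(congr1 (@sabic_op _ _ a)).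
- move=> A mA; under eq_bigr do rewrite adjT.
  rewrite big_ord_recl big_ord1 !step_op_conj_tilt // !p2 !q2 /=.
  have comb (x x' y y' u v : bop H) :
      x * u + y * v + (x' * u + y' * v) = (x + x') * u + (y + y') * v.
    by rewrite addrACA !mulrDl.
  have r1 : rsc a d1 + rsc a (1 - d1) = 1 by rewrite -rmorphD subrKC rmorph1.
  have r2 : rsc a (e1 - d1) * C + rsc a (1 - e1 - (1 - d1)) * C = 0.
    rewrite -mulrDl -rmorphD.
    have -> : e1 - d1 + (1 - e1 - (1 - d1)) = 0 by ring.
    by rewrite rmorph0 mul0r.
  rewrite comb -[_ + _ : bop H]/(sabic_op (rsc a d1 + rsc a (1 - d1))) r1.
  rewrite -[X in _ + X * _]/(sabic_op (rsc a (e1 - d1) * C +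
                                       rsc a (1 - e1 - (1 - d1)) * C)) r2.
  by rewrite mul1r mul0r addr0.
move=> U [uU nuU].
have := nuU ord0 E mE.
set V := adj (U ord0); set W := U ord0.
have VW : V * W = 1 by have [] := uU ord0.
have WV : W * V = 1 by have [] := uU ord0.
(* mu (E & ~E) = 0, and l = (s^2 / 2) / (s / 2) = s. *)
have nuE : nu ord0 E = (tilt_weight P C s * effect : sabic a).
  rewrite /nu /tilt setICr (povm0 pmu.1) mulr0 mul0r addr0 setIid.
  rewrite p2 q2 /= /d1 /e1.
  by have -> : s ^+ 2 / 2 / (s / 2) = s by field; rewrite gt_eqF.
rewrite nuE => eqg; set g := tilt_weight P C s * effect in eqg.
have muEW : mu E = W * (g : bop H) * V.
  by rewrite eqg !mulrA WV mul1r -mulrA WV mulr1.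
have -> : (effect - effect * effect) h = W ((g - g * g) (V h)).
  rewrite (sabicBE effect) (sabicME effect) effectE (sabicBE g) (sabicME g).
  by rewrite -(conj_sub_sqr _ _ VW) -muEW.
have adjV k l : rip (V k) l = rip k (W l) by rewrite /rip unitary_adj.
rewrite -adjV -[leRHS]mulr1.
have -> : rip h h = rip (V h) (V h) by rewrite adjV -bopME WV bop1E.
have := tilted_effect_sub_sqr_le PP tC (ltW s0) effect_pos effect_le1 Pt (V h).
by rewrite sabicBE ripBr rscE ripZr subr_ge0 mulr1.
Qed.

End ExtremeDecomposition.

(** * Effects that commute with the POVM below them *)

Section Conclusion.
Context {d : measure_display} {X : measurableType d}.
Context {R : realType} {H : hilbertType R}.

(** The bound mu E - mu E ^ 2 <= s holds for every s in ]0, 1[. *)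
Lemma commuting_block_projection (mu : set X -> bop H) E :
  cstar_extreme mu -> measurable E ->
  (forall A, measurable A -> A `<=` E -> mu A * mu E = mu E * mu A) ->
  projection (mu E).
Proof.
move=> cmu mE muE.
have pmu := cmu.1; pose t := effect pmu mE.
have le s h : 0 < s < 1 -> rip h ((t - t * t) h) <= s * rip h h.
  move=> s01.
  have [P [C [[PP PC tC] [C0 CP Pt]]]] :=
    spectral_cut s01 (effect_pos pmu mE) (effect_le1 pmu mE).
  exact: (effect_sub_sqr_le muE s01 PP PC tC C0 CP Pt h cmu).
have ge0 : spos (t - t * t).
  by apply: spos_sub_sqr; [exact: effect_pos|exact: effect_le1].
have eq0 h : rip h ((t - t * t) h) = 0.
  apply/eqP; rewrite eq_le ge0 andbT; apply/ler_addgt0Pr => e e0.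
  rewrite add0r.
  have hh : 0 < rip h h + 1 by rewrite ltr_wpDl ?rip_ge0.
  pose s := Num.min (e / (rip h h + 1)) 2^-1.
  have s0 : 0 < s by rewrite lt_min divr_gt0 //= invr_gt0.
  have s1 : s < 1 by rewrite gt_min; apply/orP; right; lra.
  apply: le_trans (le s h _) _; first by rewrite s0.
  have : s <= e / (rip h h + 1) by rewrite ge_min lexx.
  rewrite ler_pdivlMr //; apply: le_trans; rewrite ler_wpM2l ?(ltW s0) //.
  by rewrite lerDl.
(* t - t^2 is a positive contraction whose form vanishes, hence it is 0. *)
have idem : t * t = t.
  apply/esym/eqP; rewrite -subr_eq0; apply/eqP/sabicP => h.
  apply/eqP; rewrite -[_ == _]/((t - t * t) h == 0) -rip_eq0.
  rewrite eq_le rip_ge0 andbT -(eq0 h).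
  apply: rip_sqr_le_of_contraction; first exact: sabic_selfadj.
  by move=> k; rewrite eq0 lexx rip_ge0.
split; last exact: (congr1 (@sabic_op _ _ _) idem).
by apply: selfadj_adj; exact: (sabic_selfadj t).
Qed.

End Conclusion.

Theorem theorem3p8 (R : realType) (d : measure_display) (X : measurableType d)
    (H : hilbertType R) (mu : set X -> bop H) :
  (forall x : X, measurable [set x]) ->
  separable_space H ->
  cstar_extreme mu ->
  (forall E : set X, measurable E ->
     (forall A : set X, measurable A -> A `<=` E -> mu A * mu E = mu E * mu A) ->
     projection (mu E)) /\
  (forall E : set X, measurable E ->
     (forall B : set X, measurable B -> mu E * mu B = mu B * mu E) ->
     projection (mu E)).
Proof.
move=> _ _ cmu; split=> E mE muE; apply: (commuting_block_projection cmu) => //.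
by move=> A mA _; rewrite muE.
Qed.
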